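(* Let $p\geq 2$ and let $G$ be a $K_{1,p+1}$-free $2p$-regular graph. Then $G$ is $(p+2)$-star colourable if and only if $G$ admits a locally bijective homomorphism to $L^*(K_{p+2})$.
   Context: Graphs are finite and simple. $K_{1,p+1}$-free means no induced subgraph isomorphic to $K_{1,p+1}$. A $k$-star colouring is a proper colouring with $k$ colours in which the subgraph induced by any two colour classes has every connected component a star $K_{1,q}$ ($q\ge 0$). $L^*(K_q)$ is the undirected graph with vertex set the ordered pairs $(i,j)$ of distinct elements of $\mathbb{Z}_q$, where $(i,j)$ and $(j,k)$ are adjacent whenever $k\neq i$ (it is the underlying graph of the oriented line graph of $K_q$). A locally bijective homomorphism from $G$ to $H$ is a map $\psi\colon V(G)\to V(H)$ such that for every $v\in V(G)$ the restriction of $\psi$ to $N_G(v)$ is a bijection onto $N_H(\psi(v))$. *)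

(* Defs.v *)
From mathcomp Require Import all_boot.

Set Implicit Arguments.
Unset Strict Implicit.
Unset Printing Implicit Defensive.

Record sgraph := SGraph {
  vertex :> finType;
  adj : rel vertex;
  adj_sym : symmetric adj;
  adj_irrefl : irreflexive adj }.

Arguments adj {s}.

Definition isomorphic (G H : sgraph) : Prop :=
  exists2 f : G -> H, bijective f & {mono f : x y / adj x y}.

Section Induced.
Variables (G : sgraph) (A : {set G}).

Definition induced_adj : rel {x : G | x \in A} :=
  fun x y => adj (val x) (val y).

Lemma induced_adj_sym : symmetric induced_adj.
Proof. by move=> x y; apply: adj_sym. Qed.

Lemma induced_adj_irrefl : irreflexive induced_adj.
Proof. by move=> x; apply: adj_irrefl. Qed.

Definition induced : sgraph := SGraph induced_adj_sym induced_adj_irrefl.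
End Induced.

Section CompleteBipartite.
Variables m n : nat.

Definition Kbip_adj : rel ('I_m + 'I_n)%type :=
  fun x y => is_inl x != is_inl y.

Lemma Kbip_adj_sym : symmetric Kbip_adj.
Proof. by move=> x y; rewrite /Kbip_adj eq_sym. Qed.

Lemma Kbip_adj_irrefl : irreflexive Kbip_adj.
Proof. by move=> x; rewrite /Kbip_adj eqxx. Qed.

Definition Kbip : sgraph := SGraph Kbip_adj_sym Kbip_adj_irrefl.
End CompleteBipartite.

Definition star (q : nat) : sgraph := Kbip 1 q.

Definition induced_free (H G : sgraph) : Prop :=
  ~ exists A : {set G}, isomorphic (induced A) H.

Definition nbhd (G : sgraph) (v : G) : {set G} := [set u | adj v u].

Definition regular (d : nat) (G : sgraph) : Prop :=
  forall v : G, #|nbhd v| = d.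

Definition component (G : sgraph) (v : G) : {set G} :=
  [set u | connect adj v u].

Definition proper_colouring (k : nat) (G : sgraph) (c : G -> 'I_k) : Prop :=
  forall x y : G, adj x y -> c x != c y.

Definition colour_classes2 (k : nat) (G : sgraph) (c : G -> 'I_k)
    (a b : 'I_k) : {set G} :=
  [set x | (c x == a) || (c x == b)].

(* Colour classes may be empty: c is not required to be surjective. *)
Definition star_colouring (k : nat) (G : sgraph) (c : G -> 'I_k) : Prop :=
  proper_colouring c /\
  forall a b : 'I_k, a != b ->
  forall x : induced (colour_classes2 c a b),
  exists q : nat, isomorphic (induced (component x)) (star q).

Definition star_colourable (k : nat) (G : sgraph) : Prop :=
  exists c : G -> 'I_k, star_colouring c.

Section Lstar.
Variable q : nat.

(* 'I_q stands for Z_q: only the underlying set of q elements matters, and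
   'I_q has q elements for every q. *)
Definition Lstar_vertex := {ij : 'I_q * 'I_q | ij.1 != ij.2}.

Definition Lstar_arc : rel Lstar_vertex :=
  fun u v => ((val u).2 == (val v).1) && ((val v).2 != (val u).1).

Definition Lstar_adj : rel Lstar_vertex :=
  fun u v => Lstar_arc u v || Lstar_arc v u.

Lemma Lstar_adj_sym : symmetric Lstar_adj.
Proof. by move=> u v; rewrite /Lstar_adj orbC. Qed.

Lemma Lstar_adj_irrefl : irreflexive Lstar_adj.
Proof.
move=> u; rewrite /Lstar_adj orbb /Lstar_arc [_ == _]eq_sym.
by rewrite (negbTE (valP u)).
Qed.

Definition Lstar : sgraph := SGraph Lstar_adj_sym Lstar_adj_irrefl.
End Lstar.

(* The image condition already makes psi a graph homomorphism. *)
Definition locally_bijective (G H : sgraph) (psi : G -> H) : Prop :=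
  forall v : G,
    {in nbhd v &, injective psi} /\ psi @: nbhd v = nbhd (psi v).

(* Main.v *)
(** Let [c] be a [p+2]-star colouring and let [out v] be the set of neighbours
    [w] of [v] whose colour occurs at least twice around [v]. As bicoloured
    components are stars, an edge [vw] cannot have both [w \in out v] and
    [v \in out w]; hence the sets [out v] have average size at most [p].
    Conversely the neighbours outside [out v] have distinct colours, so
    [#|out v| >= p], and equality must hold everywhere. It forces all of
    [out v] to have a single colour [s v], each other colour to occur exactly
    once around [v], and every edge to be oriented exactly one way. The map
    [v |-> (c v, s v)] is then a homomorphism to the line graph; it is locally
    bijective because, for an in-neighbour [x] of [v], the [p+1] neighbours
    [x |: out v] of [v] are not independent, so [x] is an out-neighbour of some
    [w \in out v] and [s w = c x]. In the other direction, the first coordinate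
    of a locally bijective homomorphism is a star colouring: the component of
    the colours [a], [b] around a vertex over [(a, b)] consists of this vertex
    and its out-neighbours. *)
Require Import Defs.
From mathcomp Require Import all_boot zify.

Set Implicit Arguments.
Unset Strict Implicit.
Unset Printing Implicit Defensive.

(** * Recognising stars, and a double count *)

Lemma isomorphic_star (H : sgraph) (r : H) (n : nat) :
  #|H| = n.+1 -> (forall x y : H, adj x y = ((x == r) != (y == r))) ->
  isomorphic H (star n).
Proof.
move=> cardH adjE.
have cardC : #|[set~ r]| = n by rewrite cardsC1 cardH.
(* The one-vertex star is treated apart, because [enum_rank_in] needs some vertex other than the
   centre. *)
case: n cardH cardC => [|n] cardH cardC.
  have xr x : x = r by exact: (fintype_le1P (eq_leq cardH)).
  exists (fun=> inl ord0); last by move=> x y; rewrite adjE (xr x) (xr y) eqxx.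
  by apply: inj_card_bij => [x y _|];
     rewrite ?cardH ?card_sum ?card_ord // (xr x) (xr y).
have [x0 x0P] : exists x0, x0 \in [set~ r].
  by apply/set0Pn; rewrite -card_gt0 cardC.
pose f x : star n.+1 :=
  if x == r then inl ord0 else inr (cast_ord cardC (enum_rank_in x0P x)).
have f_inl x : is_inl (f x) = (x == r) by rewrite /f; case: eqP.
exists f; last by move=> x y; rewrite adjE /= /Kbip_adj !f_inl.
apply: inj_card_bij; last by rewrite cardH card_sum !card_ord.
move=> x y; rewrite /f; case: eqP => [-> | /eqP xr]; case: eqP => [-> | /eqP yr] //.
by case=> /val_inj/enum_rank_in_inj; apply; rewrite in_setC1.
Qed.

Lemma isomorphic_induced_star (G : sgraph) (A : {set G}) (r : G) (n : nat) :
  r \in A -> #|A| = n.+1 ->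
  {in A &, forall x y, adj x y = ((x == r) != (y == r))} ->
  isomorphic (induced A) (star n).
Proof.
move=> rA cardA adjE.
apply: (@isomorphic_star (induced A) (exist _ r rA)).
  by rewrite card_sig -cardA; apply: eq_card => x.
by move=> x y; rewrite /= /induced_adj adjE ?(valP x) ?(valP y).
Qed.

(** Otherwise [v] and [n] elements of [S] would induce a star with centre [v]. *)
Lemma independent_nbhd_card (G : sgraph) (n : nat) (v : G) (S : {set G}) :
  induced_free (star n) G -> S \subset nbhd v ->
  {in S &, forall x y, ~~ adj x y} -> #|S| < n.
Proof.
move=> free /subsetP SN indS; rewrite ltnNge; apply/negP => /card_geqP[t [ut st tS]].
apply: free; exists (v |: [set x in t]).
have vt : v \notin [set x in t].
  by rewrite inE; apply/negP => /tS/SN; rewrite inE adj_irrefl.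
have adjv x : x \in t -> adj v x by move=> /tS/SN; rewrite inE.
have neqv x : x \in t -> x == v = false.
  by move=> xt; apply: contraNF vt => /eqP <-; rewrite inE.
apply: (@isomorphic_induced_star _ _ v); first by rewrite setU11.
  by rewrite cardsU1 vt cardsE (card_uniqP ut) st.
move=> x y; rewrite !inE => /predU1P[-> | xt] /predU1P[-> | yt].
- by rewrite adj_irrefl !eqxx.
- by rewrite adjv // eqxx neqv.
- by rewrite adj_sym adjv // eqxx neqv.
- by rewrite !neqv //; apply/negbTE/indS; apply: tS.
Qed.

(** Neighbours of [r] have no neighbour but [r], so [r |: nbhd r] is closed under adjacency and is
    the whole component. *)
Lemma component_star (G : sgraph) (x r : G) :
  connect adj x r -> (forall y z : G, adj r y -> adj y z -> z = r) ->
  isomorphic (induced (component x)) (star #|nbhd r|).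
Proof.
move=> xr nbr_leaf.
have csym : connect_sym (@adj G) by apply: sym_connect_sym; apply: adj_sym.
have compE : component x = r |: nbhd r.
  apply/setP => y; rewrite !inE (same_connect csym xr).
  apply/idP/predU1P => [/connectP[q] | [-> | /connect1 //]]; last exact: connect0.
  elim/last_ind: q y => [|q z IH] y /=; first by left.
  rewrite rcons_path last_rcons => /andP[/IH/(_ erefl) qP lz] ->.
  case: qP lz => [-> | /nbr_leaf leaf /leaf]; by [right | left].
apply: (@isomorphic_induced_star _ _ r).
- by rewrite inE.
- by rewrite compE cardsU1 inE adj_irrefl.
have neqr y : adj r y -> y == r = false.
  by apply: contraTF => /eqP ->; rewrite adj_irrefl.
move=> y z; rewrite compE !inE => /predU1P[-> | ry] /predU1P[-> | rz].
- by rewrite adj_irrefl eqxx.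
- by rewrite rz eqxx neqr.
- by rewrite adj_sym ry eqxx neqr.
- rewrite !neqr //; apply/negbTE/negP => /(nbr_leaf _ _ ry) zr.
  by move: rz; rewrite zr adj_irrefl.
Qed.

(** The vertices [u], [u'] lie on one side of the bipartition and [v], [v'] on the other; one of the
    sides is just the centre. *)
Lemma star_no_path4 (q : nat) (u v u' v' : star q) :
  adj v' u -> adj u v -> adj v u' -> u = u' \/ v = v'.
Proof.
by case: u v u' v' => [u|u] [v|v] [u'|u'] [v'|v'] //= _ _ _;
   [left | right]; rewrite (ord1 u) (ord1 u') || rewrite (ord1 v) (ord1 v').
Qed.

Lemma star_colouring_no_path4 (k : nat) (G : sgraph) (c : G -> 'I_k)
    (u v u' v' : G) :
  star_colouring c -> adj v' u -> adj u v -> adj v u' ->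
  c u' = c u -> c v' = c v -> u = u' \/ v = v'.
Proof.
move=> [proper stars] v'u uv vu' cu' cv'.
pose A := colour_classes2 c (c u) (c v).
have uA : u \in A by rewrite inE eqxx.
have vA : v \in A by rewrite inE eqxx orbT.
have u'A : u' \in A by rewrite inE cu' eqxx.
have v'A : v' \in A by rewrite inE cv' eqxx orbT.
pose U : induced A := exist _ u uA.
pose V : induced A := exist _ v vA.
pose U' : induced A := exist _ u' u'A.
pose V' : induced A := exist _ v' v'A.
have [q [f /bij_inj f_inj f_mono]] := stars _ _ (proper _ _ uv) U.
have UC : U \in component U by rewrite inE connect0.
have VC : V \in component U by rewrite inE connect1.
have U'C : U' \in component U.
  by rewrite inE (@connect_trans _ _ V) ?connect1.
have V'C : V' \in component U by rewrite inE connect1 //= /induced_adj /= adj_sym.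
pose F x (xC : x \in component U) := f (exist _ x xC).
have F_adj x y xC yC : adj (@F x xC) (@F y yC) = adj x y by rewrite f_mono.
have F_inj x y xC yC : @F x xC = @F y yC -> val x = val y.
  by move=> /f_inj/(congr1 (val \o val)).
have [] := @star_no_path4 q (F _ UC) (F _ VC) (F _ U'C) (F _ V'C);
  rewrite ?F_adj // => /F_inj; by [left | right].
Qed.

(** In-degrees and out-degrees both sum to the number of pairs in [r], so the termwise inequality
    between them is an equality. *)
Lemma double_count_eq (T : finType) (r : rel T) (m : nat) :
  (forall x, #|[set y | r y x]| <= m <= #|[set y | r x y]|) ->
  forall x, #|[set y | r y x]| = m /\ #|[set y | r x y]| = m.
Proof.
move=> bounds x.
have cardE (P : pred T) : #|[set y | P y]| = \sum_y P y.
  by rewrite -sum1dep_card big_mkcond; apply: eq_bigr => y _; case: (P y).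
have sumE : \sum_x #|[set y | r y x]| = \sum_x #|[set y | r x y]|.
  under eq_bigr do rewrite cardE.
  by rewrite exchange_big; under eq_bigr do rewrite -cardE.
have le_io y : #|[set z | r z y]| <= #|[set z | r y z]|.
  by have /andP[] := bounds y; apply: leq_trans.
have := leqif_sum (fun y (_ : true) => leqif_eq (le_io y)).
rewrite sumE => -[_]; rewrite eqxx => /esym/forallP/(_ x)/eqP io.
by have := bounds x; rewrite io => /anti_leq ->.
Qed.

(** * From a star colouring to a locally bijective homomorphism *)

Section StarColouring.
Variables (p : nat) (G : sgraph) (c : G -> 'I_p.+2).
Hypotheses (p_ge2 : 2 <= p) (free : induced_free (star p.+1) G).
Hypotheses (reg : regular (2 * p) G) (cP : star_colouring c).

Definition out (v w : G) : bool :=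
  adj v w && [exists u, [&& adj v u, c u == c w & u != w]].

Let outs v := [set w | out v w].
Let ins v := [set w | out w v].
Let others v := nbhd v :\: outs v.

(** Otherwise a second neighbour [w'] of [v] with the colour of [w] and a second neighbour [v'] of
    [w] with the colour of [v] give a bicoloured path [w' v w v']. *)
Lemma out_asym v w : out v w -> ~~ out w v.
Proof.
move=> /andP[vw /existsP[w' /and3P[vw' /eqP cw' w'w]]]; apply/negP.
move=> /andP[wv /existsP[v' /and3P[wv' /eqP cv' v'v]]].
have := star_colouring_no_path4 cP _ vw wv' cv' cw'.
by rewrite adj_sym => /(_ vw')[] /esym/eqP; apply/negP.
Qed.

Lemma outs_sub v : outs v \subset nbhd v.
Proof. by apply/subsetP => w; rewrite !inE => /andP[]. Qed.

Lemma ins_sub v : ins v \subset others v.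
Proof.
apply/subsetP => w; rewrite !inE => vw; rewrite out_asym //=.
by rewrite adj_sym; case/andP: vw.
Qed.

Lemma others_inj v : {in others v &, injective c}.
Proof.
move=> w w'; rewrite !inE => /andP[nout vw] /andP[_ vw'] cww'.
apply/eqP; rewrite eq_sym; apply: contraNT nout => neq.
by rewrite /out vw; apply/existsP; exists w'; rewrite vw' neq cww' eqxx.
Qed.

Lemma out_colour v w w' : out v w' -> adj v w -> c w = c w' -> out v w.
Proof.
case: (eqVneq w w') => [-> // | neq] /andP[vw' _] vw cww'.
by rewrite /out vw; apply/existsP; exists w'; rewrite vw' cww' eqxx eq_sym.
Qed.

Lemma others_colours v :
  c @: others v \subset ~: (c v |: c @: outs v).
Proof.
apply/subsetP => _ /imsetP[w wP ->]; rewrite !inE negb_or.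
move: wP; rewrite !inE => /andP[nout vw].
rewrite eq_sym cP.1 //=; apply: contra nout => /imsetP[w']; rewrite inE.
by move=> vw' /(out_colour vw')->.
Qed.

Lemma colour_notin_outs v : c v \notin c @: outs v.
Proof.
apply/negP => /imsetP[w]; rewrite inE => /andP[/cP.1 + _] cvw.
by rewrite cvw eqxx.
Qed.

Lemma card_outs_others v : #|outs v| + #|others v| = 2 * p.
Proof.
by rewrite -(reg v) -(cardsID (outs v) (nbhd v)) (setIidPr (outs_sub v)).
Qed.

(** The colours on [others v] are distinct and avoid both [c v] and the colours on [outs v]. *)
Lemma card_others_colours v : #|others v| + #|c @: outs v| <= p.+1.
Proof.
rewrite -(card_in_imset (@others_inj v)).
have := subset_leq_card (others_colours v).
have := cardsC (c v |: c @: outs v); rewrite card_ord cardsU1 colour_notin_outs.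
lia.
Qed.

Lemma card_outs_ge v : p <= #|outs v|.
Proof.
have := card_others_colours v; have := card_outs_others v.
(* If [outs v] were empty, [2 * p] neighbours would have distinct colours among [p.+1], against
   [2 <= p]. *)
have [-> | /set0Pn[w wP]] := eqVneq (outs v) set0; first by rewrite cards0; lia.
have : 0 < #|c @: outs v|.
  by rewrite card_gt0; apply/set0Pn; exists (c w); apply: imset_f.
lia.
Qed.

(** The double count applies since [#|ins v| <= 2 * p - #|outs v| <= p <= #|outs v|]. *)
Lemma card_ins_outs v : #|ins v| = p /\ #|outs v| = p.
Proof.
apply: double_count_eq => {}v; rewrite card_outs_ge andbT.
apply: leq_trans (subset_leq_card (ins_sub v)) _.
have := card_outs_others v; have := card_outs_ge v; lia.
Qed.

Lemma others_ins v : others v = ins v.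
Proof.
apply/esym/eqP; rewrite eqEcard ins_sub.
have := card_outs_others v; have [-> ->] := card_ins_outs v; lia.
Qed.

(** As [others v] uses [p] colours, the bound [p.+1] leaves only one for [outs v]. *)
Lemma outs_one_colour v : exists j, c @: outs v == [set j].
Proof.
suff /cards1P[j ->] : #|c @: outs v| == 1 by exists j.
have := card_others_colours v.
have [cardI cardO] := card_ins_outs v; rewrite others_ins cardI.
have : 0 < #|c @: outs v|.
  have [w wP] : exists w, w \in outs v.
    by apply/set0Pn; rewrite -card_gt0 cardO; lia.
  by rewrite card_gt0; apply/set0Pn; exists (c w); apply: imset_f.
lia.
Qed.

Definition out_col v : 'I_p.+2 := xchoose (outs_one_colour v).

Lemma out_colP v : c @: outs v = [set out_col v].
Proof. exact: eqP (xchooseP (outs_one_colour v)). Qed.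

Lemma outE v w : out v w = adj v w && (c w == out_col v).
Proof.
apply/idP/andP => [vw | [vw /eqP cw]].
  by split; [case/andP: vw | rewrite -in_set1 -out_colP imset_f ?inE].
have : c w \in c @: outs v by rewrite out_colP cw set11.
by case/imsetP=> w'; rewrite inE => vw'; apply: out_colour vw' vw.
Qed.

Lemma out_col_neq v : c v != out_col v.
Proof. by have := colour_notin_outs v; rewrite out_colP inE. Qed.

Lemma adj_outN v w : adj v w -> out w v = ~~ out v w.
Proof.
move=> vw; have /setP/(_ w) := others_ins v.
by rewrite !inE vw andbT => <-.
Qed.

(** The [p] in-neighbours have distinct colours, and exactly [p] colours differ from [c v] and
    [out_col v]. *)
Lemma in_nbr v h : h != c v -> h != out_col v -> exists2 x, out x v & c x = h.
Proof.
move=> hc hs.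
have : h \in c @: others v.
  suff -> : c @: others v = ~: (c v |: c @: outs v).
    by rewrite out_colP !inE negb_or hc hs.
  apply/eqP; rewrite eqEcard others_colours card_in_imset; last exact: others_inj.
  have := cardsC (c v |: c @: outs v).
  rewrite cardsU1 colour_notin_outs out_colP cards1 others_ins card_ord.
  by have [-> _] := card_ins_outs v; lia.
by rewrite others_ins => /imsetP[x]; rewrite inE => xv ->; exists x.
Qed.

(* [x |: outs v] has [p+1] elements, so it is not independent: [x] is adjacent
   to some [w \in outs v], and [xw] can only be oriented from [w] to [x]. *)
Lemma out_nbr v h :
  h != c v -> h != out_col v -> exists2 w, out v w & out_col w = h.
Proof.
move=> hc hs; have [x xv cx] := in_nbr hc hs.
have xNout : x \notin outs v by rewrite inE out_asym.
have [xv_adj cvx] : adj x v /\ c v = out_col x.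
  by move: xv; rewrite outE => /andP[? /eqP].
have xoutN w : out v w -> out x w = false.
  rewrite !outE => /andP[_ /eqP->]; rewrite -cvx [_ == c v]eq_sym.
  by rewrite (negbTE (out_col_neq v)) andbF.
have [w vw xw] : exists2 w, out v w & adj x w.
  apply/exists_inP; apply: contraT => /exists_inPn nadj.
  have := @independent_nbhd_card _ p.+1 v (x |: outs v) free.
  rewrite cardsU1 xNout (card_ins_outs v).2 ltnn => contra.
  apply: contra.
    by rewrite subUset sub1set outs_sub inE adj_sym xv_adj.
  move=> y z; rewrite !inE => /predU1P[-> | vy] /predU1P[-> | vz].
  - by rewrite adj_irrefl.
  - exact: nadj.
  - by rewrite adj_sym; apply: nadj.
  - apply/negP => /cP.1; move: vy vz; rewrite !outE.
    by move=> /andP[_ /eqP->] /andP[_ /eqP->]; rewrite eqxx.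
exists w => //; have := adj_outN xw; rewrite xoutN // outE => /andP[_ /eqP <-].
by rewrite cx.
Qed.

Definition line_vertex v : Lstar p.+2 := exist _ (c v, out_col v) (out_col_neq v).

Lemma out_arc v w : out v w -> Lstar_arc (line_vertex v) (line_vertex w).
Proof.
move=> vw; have := out_asym vw; move: vw; rewrite !outE /Lstar_arc /=.
move=> /andP[vw /eqP->]; rewrite adj_sym vw eqxx /= eq_sym //.
Qed.

Lemma line_vertex_locally_bijective : locally_bijective line_vertex.
Proof.
move=> v; have nbr w : adj v w -> out v w \/ out w v.
  by move=> vw; case: (boolP (out v w)) => [|nvw]; [left | right; rewrite adj_outN].
split; last first.
  apply/setP => u; rewrite inE; apply/imsetP/orP => [[w] | ].
    by rewrite inE => /nbr[] /out_arc ? ->; [left | right].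
  case: u => -[i j] ij; rewrite /Lstar_arc /= in ij *.
  case=> /andP[/eqP e neq].
    have [||w vw sw] := @out_nbr v j; rewrite // ?e 1?eq_sym //.
    move: vw; rewrite outE => /andP[vw /eqP cw]; exists w; first by rewrite inE.
    by apply: val_inj; rewrite /= cw sw e.
  have [||x xv cx] := @in_nbr v i; rewrite -?e // 1?eq_sym //.
  move: xv; rewrite outE => /andP[xv /eqP cv]; exists x; first by rewrite inE adj_sym.
  by apply: val_inj; rewrite /= cx -cv e.
(* By [out_nbr], [out_col] maps the [p] out-neighbours onto the [p] colours other than [c v] and
   [out_col v]. *)
have out_inj : {in outs v &, injective out_col}.
  apply/imset_injP; rewrite eqn_leq leq_imset_card (card_ins_outs v).2 /=.
  have cardC : #|~: [set c v; out_col v]| = p.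
    have := cardsC [set c v; out_col v].
    by rewrite card_ord cards2 out_col_neq => -[].
  rewrite -{1}cardC; apply/subset_leq_card.
  apply/subsetP => h; rewrite !inE negb_or => /andP[hc hs].
  have [w vw <-] := out_nbr hc hs; by apply: imset_f; rewrite inE.
(* The first coordinate tells in-neighbours from out-neighbours, which all have colour
   [out_col v]. *)
have in_c w : out w v -> c w != out_col v.
  by move=> wv; have := out_asym wv; move: wv; rewrite !outE adj_sym => /andP[->].
move=> w w'; rewrite !inE => vw vw' [cc ss].
case: (nbr w vw) (nbr w' vw') => [ow | iw] [ow' | iw'].
- by apply: out_inj; rewrite ?inE.
- by move: (in_c _ iw') ow; rewrite outE -cc vw => /negbTE->.
- by move: (in_c _ iw) ow'; rewrite outE cc vw' => /negbTE->.
- by apply: (@others_inj v); rewrite ?others_ins ?inE.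
Qed.
End StarColouring.

(* [(h1, t1)], [(h2, t2)], [(h3, t3)] is a path of [Lstar] inside the colour
   classes [a] and [b]; it goes back and forth along a single arc. *)
Lemma alternating_arcs (T : eqType) (a b h1 t1 h2 t2 h3 t3 : T) :
  h1 = a \/ h1 = b -> h2 = a \/ h2 = b -> h3 = a \/ h3 = b ->
  t1 = a \/ t1 = b -> h1 != t1 -> h2 != t2 -> h3 != t3 ->
  (t1 = h2 /\ t2 <> h1) \/ (t2 = h1 /\ t1 <> h2) ->
  (t2 = h3 /\ t3 <> h2) \/ (t3 = h2 /\ t2 <> h3) ->
  h3 = h1 /\ t3 = t1.
Proof.
move=> h1P h2P h3P t1P /eqP n1 /eqP n2 /eqP n3 arc12 arc23.
by split; intuition congruence.
Qed.

(** * From a locally bijective homomorphism to a star colouring *)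

Section Lift.
Variables (k : nat) (G : sgraph) (psi : G -> Lstar k).
Hypothesis psiP : locally_bijective psi.

Let hd v : 'I_k := (val (psi v)).1.
Let tl v : 'I_k := (val (psi v)).2.

Lemma lift_adj v w :
  adj v w -> (tl v = hd w /\ tl w <> hd v) \/ (tl w = hd v /\ tl v <> hd w).
Proof.
move=> vw; have : psi w \in nbhd (psi v).
  by have [_ <-] := psiP v; apply: imset_f; rewrite inE.
by rewrite inE => /orP[] /andP[/eqP ? /eqP ?]; [left | right].
Qed.

Lemma lift_in_nbr v o :
  o != hd v -> o != tl v -> exists2 w, adj v w & hd w = o /\ tl w = hd v.
Proof.
move=> oh ot; pose u : Lstar k := exist _ (o, hd v) oh.
have : u \in nbhd (psi v).
  by rewrite inE; apply/orP; right; rewrite /Lstar_arc /= eqxx eq_sym ot.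
have [_ <-] := psiP v => /imsetP[w]; rewrite inE => vw uw.
by exists w; rewrite // /hd /tl -uw.
Qed.

Lemma lift_inj v w w' :
  adj v w -> adj v w' -> hd w = hd w' -> tl w = tl w' -> w = w'.
Proof.
move=> vw vw' eh et; have [inj _] := psiP v; apply: inj; rewrite ?inE //.
by apply: val_inj; rewrite [LHS]surjective_pairing [RHS]surjective_pairing; congr pair.
Qed.

Lemma lift_star_colouring : star_colouring hd.
Proof.
have hd_tl v : hd v != tl v := valP (psi v).
split=> [v w vw | a b ab x].
  have := hd_tl v; have := hd_tl w.
  by case: (lift_adj vw) => -[-> _] => [_|+ _] //; rewrite eq_sym.
pose K := induced (colour_classes2 hd a b).
have hdK (y : K) : hd (val y) = a \/ hd (val y) = b.
  by have := valP y; rewrite inE => /orP[] /eqP; [left | right].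
(* The centre [r] lies over [(a, b)] or [(b, a)]: it is [x] itself or, if [tl] of [x] is a third
   colour, the in-neighbour of [x] coloured with the other of [a], [b]. *)
have [r xr rP] : exists2 r : K, connect adj x r & tl (val r) = a \/ tl (val r) = b.
  have [tx | tx] := boolP ((tl (val x) == a) || (tl (val x) == b)).
    by exists x => //; case/orP: tx => /eqP; [left | right].
  pose o := if hd (val x) == a then b else a.
  have oP : o = a \/ o = b by rewrite /o; case: ifP; [right | left].
  have [||w xw [hw tw]] := @lift_in_nbr (val x) o.
  - by rewrite /o; case: (hd (val x) =P a) => [->|/eqP]; rewrite eq_sym.
  - by rewrite eq_sym; case: oP => ->; apply: contra tx => ->; rewrite ?orbT.
  have wK : w \in colour_classes2 hd a b.
    by rewrite inE hw; case: oP => ->; rewrite eqxx ?orbT.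
  exists (exist _ w wK); first exact: connect1.
  by rewrite /= tw; apply: hdK.
exists #|nbhd r|; apply: component_star xr _ => y z ry yz.
(* Both [z] and [r] are neighbours of [y], so once their images agree, local injectivity at [y]
   identifies them. *)
have [hzr tzr] : hd (val z) = hd (val r) /\ tl (val z) = tl (val r).
  exact: (alternating_arcs (hdK r) (hdK y) (hdK z) rP (hd_tl _) (hd_tl _)
            (hd_tl _) (lift_adj ry) (lift_adj yz)).
by apply: val_inj; apply: (@lift_inj (val y)); rewrite // adj_sym.
Qed.
End Lift.

Theorem theorem13 (p : nat) (G : sgraph) :
  2 <= p ->
  induced_free (star p.+1) G ->
  regular (2 * p) G ->
  star_colourable p.+2 G <->
  exists psi : G -> Lstar p.+2, locally_bijective psi.
Proof.
move=> p_ge2 free reg; split=> [[c cP] | [psi psiP]].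
  by exists (line_vertex p_ge2 reg cP); apply: line_vertex_locally_bijective.
by exists (fun v => (val (psi v)).1); apply: lift_star_colouring.
Qed.
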